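(* Let $p$ be an odd prime, let $q\in\mathbb{C}_p$ with $q\neq 1$ and $|1-q|_p<p^{-1/(p-1)}$, and let $x\in\mathbb{Z}_p$. Let $n\ge 1$ and let $w_1,\dots,w_n\in\mathbb{N}$ be positive integers with $w_1\equiv w_2\equiv\cdots\equiv w_n\equiv 1\pmod 2$. For $\sigma\in S_n$ put $W_\sigma=\prod_{j=1}^{n-1}w_{\sigma(j)}$ and, for integers $k_1,\dots,k_{n-1}$, put $$K_\sigma(k_1,\dots,k_{n-1})=\sum_{j=1}^{n-1}\Big(\prod_{\substack{1\le i\le n-1\\ i\ne j}}w_{\sigma(i)}\Big)k_j .$$ Then for every integer $m\ge 0$, the expression $$\frac{[W_\sigma]_q^{m}}{[2]_{q^{W_\sigma}}}\sum_{k_1=0}^{w_{\sigma(1)}-1}\cdots\sum_{k_{n-1}=0}^{w_{\sigma(n-1)}-1}(-1)^{k_1+\cdots+k_{n-1}}\,q^{w_{\sigma(n)}K_\sigma(k_1,\dots,k_{n-1})}\,\mathcal{E}_{m,q^{W_\sigma}}\!\left(w_{\sigma(n)}x+w_{\sigma(n)}\sum_{j=1}^{n-1}\frac{k_j}{w_{\sigma(j)}}\right)$$ is the same for every $\sigma\in S_n$.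
   Context: $\mathbb{Z}_p$ is the ring of $p$-adic integers and $\mathbb{C}_p$ is the completion of an algebraic closure of $\mathbb{Q}_p$, with norm normalized by $|p|_p=1/p$. $S_n$ is the symmetric group on $\{1,\dots,n\}$. For $Q\in\mathbb{C}_p$ with $Q\ne1$ and $|1-Q|_p<p^{-1/(p-1)}$, write $Q^z=\exp(z\log Q)$ and $[z]_Q=\frac{1-Q^z}{1-Q}$, for $z\in\mathbb{Z}_p$ and more generally for $z\in\mathbb{Q}_p$ for which the exponential converges. (If $Q=q^W$ with $W$ a positive integer, then $Q$ again satisfies these conditions, and $Q^z=q^{Wz}$ is defined whenever $Wz\in\mathbb{Z}_p$; this covers all arguments occurring in the claim.) Carlitz-type $q$-Euler numbers $\mathcal{E}_{m,Q}$ ($m\ge0$) are defined recursively by $\mathcal{E}_{0,Q}=1$ and $$Q\sum_{l=0}^{m}\binom{m}{l}Q^{l}\mathcal{E}_{l,Q}+\mathcal{E}_{m,Q}=[2]_Q\,\delta_{0,m}\qquad(m\ge0),$$ where $\delta$ is the Kronecker delta. The Carlitz-type $q$-Euler polynomials are $$\mathcal{E}_{m,Q}(z)=\sum_{l=0}^{m}\binom{m}{l}Q^{lz}\,\mathcal{E}_{l,Q}\,[z]_Q^{m-l}\qquad(m\ge 0),$$ with the convention $0^0=1$; equivalently, $\mathcal{E}_{m,Q}(z)=\int_{\mathbb{Z}_p}[z+y]_Q^m\,d\mu_{-Q}(y)$, where $$\int_{\mathbb{Z}_p}f(y)\,d\mu_{-Q}(y)=\lim_{N\to\infty}\frac{1+Q}{1+Q^{p^N}}\sum_{y=0}^{p^N-1}f(y)(-Q)^y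 .$$ Empty products equal $1$, empty sums equal $0$; when $n=1$ the iterated sum over the $k_j$ consists of a single term. *)

(* Defs.v *)
From HB Require Import structures.
From mathcomp Require Import all_boot all_order all_algebra all_fingroup.
From mathcomp Require Import boolp classical_sets reals topology normedtype
  sequences exp.

Set Implicit Arguments.
Unset Strict Implicit.
Unset Printing Implicit Defensive.

Import Order.TTheory GRing.Theory Num.Theory numFieldNormedType.Exports.

Local Open Scope classical_set_scope.
Local Open Scope ring_scope.

(* The MathComp hierarchy has no fields with a real-valued ultrametric norm,  *)
(* so C_p is given as any field K with a norm nrm : K -> R satisfying [is_Cp] *)
(* below; Q_p, its algebraic closure and Z_p are subsets of K.  C_p is        *)
(* determined by [is_Cp] up to isometric isomorphism.                         *)

Record ultrametric_norm (R : realType) (K : fieldType) (nrm : K -> R) : Prop :=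
  UltrametricNorm {
    un_ge0 : forall x, 0 <= nrm x;
    un_eq0 : forall x, nrm x = 0 <-> x = 0;
    un_mul : forall x y, nrm (x * y) = nrm x * nrm y;
    un_add : forall x y, nrm (x + y) <= Num.max (nrm x) (nrm y)
  }.

Definition ncvg (R : realType) (K : fieldType) (nrm : K -> R)
    (u : nat -> K) (l : K) : Prop :=
  (fun n => nrm (u n - l)) @ \oo --> (0 : R).

Definition ncauchy (R : realType) (K : fieldType) (nrm : K -> R)
    (u : nat -> K) : Prop :=
  forall e : R, 0 < e ->
    exists N : nat, forall i j : nat,
      (N <= i)%N -> (N <= j)%N -> nrm (u i - u j) < e.

Definition nclosure (R : realType) (K : fieldType) (nrm : K -> R)
    (A : set K) : set K :=
  [set x | forall e : R, 0 < e -> exists2 y, A y & nrm (x - y) < e].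

(* In a complete K with |p| = 1/p, the closures of the images of the          *)
(* rationals and of the integers are their p-adic completions.                *)
Definition padic_Q (R : realType) (K : fieldType) (nrm : K -> R) : set K :=
  nclosure nrm (range (@ratr K)).

Definition padic_Z (R : realType) (K : fieldType) (nrm : K -> R) : set K :=
  nclosure nrm (range (fun z : int => z%:~R : K)).

Definition padic_Qbar (R : realType) (K : fieldType) (nrm : K -> R) : set K :=
  [set x | exists P : {poly K},
     [/\ P != 0, forall i, padic_Q nrm P`_i & root P x]].

Record is_Cp (p : nat) (R : realType) (K : fieldType) (nrm : K -> R) : Prop :=
  IsCp {
    Cp_norm : ultrametric_norm nrm;
    Cp_norm_p : nrm p%:R = p%:R^-1;
    Cp_complete : forall u, ncauchy nrm u -> exists l, ncvg nrm u l;
    Cp_closed : forall P : {poly K}, (forall i, padic_Qbar nrm P`_i) ->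
      (1 < size P)%N -> exists2 x, padic_Qbar nrm x & root P x;
    Cp_dense : nclosure nrm (padic_Qbar nrm) = setT
  }.

(* Total limit operator: 0 when u does not converge. *)
Definition nlim (R : realType) (K : fieldType) (nrm : K -> R)
    (u : nat -> K) : K :=
  xget 0 [set l | ncvg nrm u l].

Definition nexp (R : realType) (K : fieldType) (nrm : K -> R) (x : K) : K :=
  nlim nrm (fun n => \sum_(0 <= i < n) x ^+ i / (i`!)%:R).

Definition nlog (R : realType) (K : fieldType) (nrm : K -> R) (x : K) : K :=
  nlim nrm (fun n => \sum_(1 <= i < n) (-1) ^+ i.+1 * (x - 1) ^+ i / i%:R).

(* Q^z for a p-adic exponent z.  Powers with a natural number exponent are    *)
(* written with the ring power ^+ outside of brackets.                        *)
Definition npow (R : realType) (K : fieldType) (nrm : K -> R) (Q z : K) : K :=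
  nexp nrm (z * nlog nrm Q).

Definition qbracket (R : realType) (K : fieldType) (nrm : K -> R)
    (Q z : K) : K :=
  (1 - npow nrm Q z) / (1 - Q).

Definition is_qEuler (R : realType) (K : fieldType) (nrm : K -> R)
    (Q : K) (E : nat -> K) : Prop :=
  E 0%N = 1 /\
  forall m : nat,
    Q * (\sum_(l < m.+1) 'C(m, l)%:R * Q ^+ l * E l) + E m
    = qbracket nrm Q 2%:R * (m == 0%N)%:R.

(* For p odd, Q != 1 and |1 - Q| < p^(-1/(p-1)), the coefficient 1 + Q^(m+1)  *)
(* of E m in the recursion is nonzero, so exactly one sequence satisfies it.  *)
Definition qEuler (R : realType) (K : fieldType) (nrm : K -> R)
    (Q : K) : nat -> K :=
  xget (fun=> 0) [set E | is_qEuler nrm Q E].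

Definition qEuler_poly (R : realType) (K : fieldType) (nrm : K -> R)
    (m : nat) (Q z : K) : K :=
  \sum_(l < m.+1) 'C(m, l)%:R * npow nrm Q (l%:R * z) * qEuler nrm Q l
                  * qbracket nrm Q z ^+ (m - l).

(* The n of the mathematical statement is n.+1 here: the weights are indexed  *)
(* by 'I_n.+1, its last index is ord_max, and the indices 1..n-1 are the      *)
(* lift ord_max j (of value j) for j : 'I_n.                                  *)
Definition wfst (n : nat) (w : 'I_n.+1 -> nat) (s : 'S_n.+1) (j : 'I_n) : nat :=
  w (s (lift ord_max j)).

Definition wlast (n : nat) (w : 'I_n.+1 -> nat) (s : 'S_n.+1) : nat :=
  w (s ord_max).

Definition Wprod (n : nat) (w : 'I_n.+1 -> nat) (s : 'S_n.+1) : nat :=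
  (\prod_(j < n) wfst w s j)%N.

Definition Ksum (n : nat) (w : 'I_n.+1 -> nat) (s : 'S_n.+1)
    (k : 'I_n -> nat) : nat :=
  (\sum_(j < n) (\prod_(i < n | i != j) wfst w s i) * k j)%N.

Definition sym_expr (R : realType) (K : fieldType) (nrm : K -> R)
    (q x : K) (n : nat) (w : 'I_n.+1 -> nat) (m : nat) (s : 'S_n.+1) : K :=
  qbracket nrm q (Wprod w s)%:R ^+ m / qbracket nrm (q ^+ Wprod w s) 2%:R *
  \sum_(k : {dffun forall j : 'I_n, 'I_(wfst w s j)})
     (-1) ^+ (\sum_(j < n) k j)%N
     * q ^+ (wlast w s * Ksum w s (fun j => k j))%N
     * qEuler_poly nrm m (q ^+ Wprod w s)
         ((wlast w s)%:R * x
          + (wlast w s)%:R * \sum_(j < n) (k j)%:R / (wfst w s j)%:R).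

(* Main.v *)
(* Expanding the q-Euler polynomials gives
     E_(m,Q)(z) = (1 + Q) / (1 - Q)^m
                  * sum_l C(m,l) (-1)^l Q^(l z) / (1 + Q^(l+1)).
   Put P = prod_i w_i.  For Q = q^W_s the l-th exponential becomes
   q^(l P x) q^(l w_(s n) K_s(k)), so the sums over the k_j are geometric sums
   of odd lengths, and their product with 1 / (1 + Q^(l+1)) is
     (1 + q^((l+1) P))^(n-1) / prod_(i <= n) (1 + q^((l+1) P / w_i)),
   which does not involve s.

   The manipulations of Q^z rest on exp and log being inverse group
   isomorphisms on |x| < r and |q - 1| < r, r = p^(-1/(p-1)).  Additivity of exp
   is the Cauchy product, and log q = lim_N (q^(p^N) - 1) / p^N, which makes log
   multiplicative and gives log (exp x) = x.  Since |log q| = |q - 1|, log is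
   injective, whence exp (log q) = q. *)
Require Import Defs.
From HB Require Import structures.
From mathcomp Require Import all_boot all_order all_algebra all_fingroup.
From mathcomp Require Import boolp classical_sets reals topology normedtype
  sequences exp.
From mathcomp Require Import zify ring lra.

Set Implicit Arguments.
Unset Strict Implicit.
Unset Printing Implicit Defensive.

Import Order.TTheory GRing.Theory Num.Theory numFieldNormedType.Exports.

Local Open Scope ring_scope.

(** * Valuation of factorials *)

(** By Legendre, (p-1) v_p(n!) is n minus the base-p digit sum of n. This bound is what makes
    p^(-1/(p-1)) the radius for exp and log. *)
Lemma logn_fact_le (p n : nat) : prime p -> (p.-1 * logn p n`! <= n.-1)%N.
Proof.
move=> pr_p; case: n => [|n]; first by rewrite logn1 muln0.
have p1 := prime_gt1 pr_p.
(* The first M terms of Legendre's sum leave room for the next floor, and always for 1: this 1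
   becomes the final -1. *)
have H M : (p.-1 * (\sum_(1 <= k < M.+1) n.+1 %/ p ^ k)
            + maxn 1 (n.+1 %/ p ^ M) <= n.+1)%N.
  elim: M => [|M IH]; first by rewrite big_nil expn0 divn1; lia.
  rewrite big_nat_recr //= mulnDr.
  have := leq_divM (n.+1 %/ p ^ M) p; rewrite -divnMA -expnSr.
  move: IH; set S := (p.-1 * _)%N; set f := (_ %/ p ^ M)%N.
  set g := (_ %/ p ^ M.+1)%N => IH Hg.
  have Hg' : (p.-1 * g + g <= f)%N
    by rewrite -mulSnr prednK ?(ltnW p1) // mulnC.
  case: g Hg' {Hg} => [|g] Hg; first by rewrite muln0; lia.
  by move: Hg; set T := (p.-1 * _)%N; lia.
rewrite logn_fact //=.
have := H n.+1; set T := (p.-1 * _)%N; lia.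
Qed.

(** * Norms and limits in an ultrametric field *)

Section Ultrametric.

Variables (R : realType) (K : fieldType) (nrm : K -> R).
Hypothesis hu : ultrametric_norm nrm.

Lemma nrm_ge0 x : 0 <= nrm x. Proof. exact: un_ge0 hu x. Qed.

Lemma nrmM : {morph nrm : x y / x * y}. Proof. exact: un_mul hu. Qed.

Lemma nrm0 : nrm 0 = 0. Proof. exact/(un_eq0 hu). Qed.

Lemma nrm_eq0 x : (nrm x == 0) = (x == 0).
Proof. by apply/eqP/eqP => /(un_eq0 hu). Qed.

Lemma nrm_gt0 x : (0 < nrm x) = (x != 0).
Proof. by rewrite lt_def nrm_ge0 andbT nrm_eq0. Qed.

Lemma nrm1 : nrm 1 = 1.
Proof.
have n1 : nrm 1 != 0 by rewrite nrm_eq0 oner_eq0.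
by apply: (mulfI n1); rewrite -nrmM !mulr1.
Qed.

Lemma nrmN x : nrm (- x) = nrm x.
Proof.
suff nN1 : nrm (-1) = 1 by rewrite -mulN1r nrmM nN1 mul1r.
apply/eqP; rewrite -(@eqrXn2 _ 2) ?nrm_ge0 ?ler01 // expr1n expr2 -nrmM.
by rewrite mulrNN mulr1 nrm1.
Qed.

Lemma nrmX x n : nrm (x ^+ n) = nrm x ^+ n.
Proof. by elim: n => [|n IH]; rewrite ?expr0 ?nrm1 // !exprS nrmM IH. Qed.

Lemma nrmV x : nrm x^-1 = (nrm x)^-1.
Proof.
have [->|x0] := eqVneq x 0; first by rewrite invr0 nrm0 invr0.
apply: (mulfI (x := nrm x)); first by rewrite nrm_eq0.
by rewrite -nrmM !divff ?nrm_eq0 // nrm1.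
Qed.

Lemma nrm_sign n : nrm ((-1) ^+ n) = 1.
Proof. by rewrite nrmX nrmN nrm1 expr1n. Qed.

Lemma nrmBC x y : nrm (x - y) = nrm (y - x).
Proof. by rewrite -nrmN opprB. Qed.

Lemma nrmD_le x y B : nrm x <= B -> nrm y <= B -> nrm (x + y) <= B.
Proof.
by move=> hx hy; apply: le_trans (un_add hu x y) _; rewrite ge_max hx.
Qed.

Lemma nrmD_lt x y B : nrm x < B -> nrm y < B -> nrm (x + y) < B.
Proof.
by move=> hx hy; apply: le_lt_trans (un_add hu x y) _; rewrite gt_max hx.
Qed.

Lemma nrmB_lt x y B : nrm x < B -> nrm y < B -> nrm (x - y) < B.
Proof. by move=> hx hy; apply: nrmD_lt; rewrite ?nrmN. Qed.

Lemma nrm_sum_le (I : Type) (s : seq I) (P : pred I) (F : I -> K) (B : R) :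
  0 <= B ->
  (forall i, P i -> nrm (F i) <= B) -> nrm (\sum_(i <- s | P i) F i) <= B.
Proof.
move=> B0 hF; elim/big_ind: _ => //; first by rewrite nrm0.
by move=> x y; apply: nrmD_le.
Qed.

Lemma nrm_nat_le1 n : nrm n%:R <= 1.
Proof.
elim: n => [|n IH]; first by rewrite nrm0 ler01.
by rewrite -natr1; apply: nrmD_le; rewrite ?nrm1.
Qed.

Lemma nrm_eq1 x : nrm (1 - x) < 1 -> nrm x = 1.
Proof.
move=> hx; apply/eqP; rewrite eq_le; apply/andP; split.
  rewrite -[x](subKr 1); apply: nrmD_le; rewrite ?nrm1 // nrmN; exact: ltW.
rewrite leNgt; apply/negP => hx1.
have := nrmD_lt hx hx1; by rewrite subrK nrm1 ltxx.
Qed.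

Lemma nrm_padic_Z x : padic_Z nrm x -> nrm x <= 1.
Proof.
move=> /(_ 1 ltr01) [_ [z _ <-]] hxz.
rewrite -[x](subrK (z%:~R)); apply: nrmD_le; first exact: ltW.
by case: z {hxz} => z; rewrite ?NegzE ?mulrNz ?nrmN; exact: nrm_nat_le1.
Qed.

Lemma ncvgP (u : nat -> K) l : ncvg nrm u l <->
  forall e : R, 0 < e -> exists N, forall n, (N <= n)%N -> nrm (u n - l) < e.
Proof.
rewrite /ncvg; split.
  move=> /cvgr0Pnorm_lt h e e0; have [N _ hN] := h e e0.
  by exists N => n /hN /=; rewrite ger0_norm ?nrm_ge0.
move=> h; apply/cvgr0Pnorm_lt => e e0; have [N hN] := h e e0.
by exists N => // n /= /hN; rewrite ger0_norm ?nrm_ge0.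
Qed.

(** If l - a were longer than B, then for large n both l - u n and u n - a would be shorter than
    their sum l - a. *)
Lemma ncvg_norm_le (u : nat -> K) l a (B : R) : 0 <= B -> ncvg nrm u l ->
  (exists N, forall n, (N <= n)%N -> nrm (u n - a) <= B) -> nrm (l - a) <= B.
Proof.
move=> B0 /ncvgP ul [N hN]; rewrite leNgt; apply/negP => hB.
have [N' hN'] := ul _ (le_lt_trans B0 hB).
have := hN _ (leq_maxl N N'); have := hN' _ (leq_maxr N N').
set n := maxn _ _ => h1 /le_lt_trans /(_ hB) h2.
rewrite nrmBC in h1; have := nrmD_lt h1 h2.
by rewrite addrA subrK ltxx.
Qed.

Lemma ncvg_unique u l l' : ncvg nrm u l -> ncvg nrm u l' -> l = l'.
Proof.
move=> ul ul'; apply/eqP; rewrite -subr_eq0 -nrm_eq0 eq_le nrm_ge0 andbT.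
rewrite leNgt; apply/negP => h; have h2 : 0 < nrm (l - l') / 2 by lra.
move/ncvgP: ul' => /(_ _ h2) [N hN].
have : nrm (l - l') <= nrm (l - l') / 2.
  by apply: (ncvg_norm_le (ltW h2) ul); exists N => n /hN /ltW.
lra.
Qed.

Lemma ncvg_nlim u l : ncvg nrm u l -> nlim nrm u = l.
Proof.
by move=> ul; apply: xget_unique => // l' ul'; apply: ncvg_unique ul.
Qed.

Lemma ncvg_eventually u v l : (exists N, forall n, (N <= n)%N -> u n = v n) ->
  ncvg nrm u l -> ncvg nrm v l.
Proof.
move=> [N uv] /ncvgP ul; apply/ncvgP => e /ul [M hM].
by exists (maxn N M) => n; rewrite geq_max => /andP[/uv <- /hM].
Qed.

Lemma eq_ncvg u v l : u =1 v -> ncvg nrm u l -> ncvg nrm v l.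
Proof. by move=> uv; apply: ncvg_eventually; exists 0%N. Qed.

Lemma ncvg_cst a : ncvg nrm (fun=> a) a.
Proof. by apply/ncvgP => e e0; exists 0%N => n _; rewrite subrr nrm0. Qed.

Lemma ncvg_le0 u l (b : nat -> R) : (forall n, nrm (u n - l) <= b n) ->
  (forall e, 0 < e -> exists N, forall n, (N <= n)%N -> b n < e) ->
  ncvg nrm u l.
Proof.
move=> ub b0; apply/ncvgP => e /b0 [N hN]; exists N => n /hN.
exact: le_lt_trans.
Qed.

Lemma ncvgD u v l k : ncvg nrm u l -> ncvg nrm v k ->
  ncvg nrm (fun n => u n + v n) (l + k).
Proof.
move=> /ncvgP ul /ncvgP vk; apply/ncvgP => e e0.
have [N hN] := ul e e0; have [M hM] := vk e e0.
exists (maxn N M) => n; rewrite geq_max => /andP[/hN h1 /hM h2].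
by rewrite opprD addrACA; apply: nrmD_lt.
Qed.

Lemma ncvgZ a u l : ncvg nrm u l -> ncvg nrm (fun n => a * u n) (a * l).
Proof.
move=> /ncvgP ul; have [->|a0] := eqVneq a 0.
  apply: (eq_ncvg (u := fun=> 0 * l)) => [n|]; rewrite ?mul0r //.
  exact: ncvg_cst.
have na : 0 < nrm a by rewrite nrm_gt0.
apply/ncvgP => e e0; have [N hN] := ul _ (divr_gt0 e0 na).
by exists N => n /hN; rewrite -mulrBr nrmM ltr_pdivlMr // mulrC.
Qed.

Lemma ncvgN u l : ncvg nrm u l -> ncvg nrm (fun n => - u n) (- l).
Proof.
move=> /(ncvgZ (-1)); rewrite mulN1r; apply: eq_ncvg => n.
by rewrite mulN1r.
Qed.

Lemma ncvg0M u v k : ncvg nrm u 0 -> ncvg nrm v k ->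
  ncvg nrm (fun n => u n * v n) 0.
Proof.
move=> /ncvgP u0 /ncvgP vk; apply/ncvgP => e e0.
have [M hM] := vk 1 ltr01.
(* Once v n is within 1 of k, the ultrametric inequality bounds it by [B]. *)
pose B := Num.max 1 (nrm k); have B0 : 0 < B by rewrite lt_max ltr01.
have [N hN] := u0 _ (divr_gt0 e0 B0).
exists (maxn N M) => n; rewrite geq_max => /andP[/hN h1 /hM h2].
rewrite subr0 nrmM; rewrite subr0 ltr_pdivlMr // in h1.
apply: le_lt_trans h1; apply: ler_wpM2l; first exact: nrm_ge0.
rewrite -[v n](subrK k); apply: nrmD_le; last by rewrite le_max lexx orbT.
by rewrite le_max (ltW h2).
Qed.

Lemma ncvgM u v l k : ncvg nrm u l -> ncvg nrm v k ->
  ncvg nrm (fun n => u n * v n) (l * k).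
Proof.
move=> ul vk.
have u0 : ncvg nrm (fun n => u n - l) 0.
  by rewrite -[X in ncvg _ _ X](subrr l); exact: ncvgD ul (ncvg_cst _).
rewrite -[X in ncvg _ _ X]add0r.
apply: eq_ncvg (ncvgD (ncvg0M u0 vk) (ncvgZ l vk)) => n.
by rewrite mulrBl subrK.
Qed.

Lemma ncvg_sum (I : Type) (s : seq I) (u : I -> nat -> K) (l : I -> K) :
  (forall i, ncvg nrm (u i) (l i)) ->
  ncvg nrm (fun n => \sum_(i <- s) u i n) (\sum_(i <- s) l i).
Proof.
move=> ul; elim: s => [|i s IH].
  by rewrite big_nil; apply: eq_ncvg (ncvg_cst _) => n; rewrite big_nil.
rewrite big_cons; apply: eq_ncvg (ncvgD (ul i) IH) => n.
by rewrite big_cons.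
Qed.

Lemma geometric_small (C rho e : R) : 0 <= rho < 1 -> 0 < e ->
  exists N, forall n, (N <= n)%N -> C * rho ^+ n < e.
Proof.
move=> /andP[r0 r1] e0.
have : ((fun n => C * rho ^+ n) @ \oo --> (0 : R))%classic.
  apply: cvg_geometric; by rewrite ger0_norm.
move=> /cvgr0Pnorm_lt /(_ e e0) [N _ hN]; exists N => n /hN.
exact: le_lt_trans (ler_norm _).
Qed.

End Ultrametric.

(** * Ultrametric series *)

Section Series.

Variables (R : realType) (K : fieldType) (nrm : K -> R).
Hypothesis hu : ultrametric_norm nrm.
Hypothesis hc : forall u, ncauchy nrm u -> exists l, ncvg nrm u l.

Lemma sum_nat_sub (a : nat -> K) (k m n : nat) : (k <= m)%N -> (m <= n)%N ->
  \sum_(k <= i < n) a i - \sum_(k <= i < m) a i = \sum_(m <= i < n) a i.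
Proof.
move=> km mn.
by rewrite [X in X - _](big_cat_nat km mn) /= addrAC subrr add0r.
Qed.

Lemma ncvg_series_tail (a : nat -> K) (j k : nat) l (B : R) :
  (j <= k)%N -> 0 <= B ->
  ncvg nrm (fun n => \sum_(j <= i < n) a i) l ->
  (forall i, (k <= i)%N -> nrm (a i) <= B) ->
  nrm (l - \sum_(j <= i < k) a i) <= B.
Proof.
move=> jk B0 al aB; apply: (ncvg_norm_le hu B0 al).
exists k => n kn; rewrite sum_nat_sub // big_nat.
by apply: (nrm_sum_le hu _ B0) => i /andP[/aB].
Qed.

(** A block of terms is no longer than its longest term, so small terms already make the partial
    sums Cauchy. *)
Lemma ncvg_geometric (a : nat -> K) (k : nat) (rho : R) : 0 <= rho < 1 ->
  (forall i, (k <= i)%N -> nrm (a i) <= rho ^+ i) ->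
  exists l, ncvg nrm (fun n => \sum_(k <= i < n) a i) l.
Proof.
move=> hr ha; apply: hc => e e0.
have [N hN] := geometric_small 1 hr e0.
have h m n : (maxn N k <= m)%N -> (m <= n)%N ->
    nrm (\sum_(k <= i < n) a i - \sum_(k <= i < m) a i) < e.
  rewrite geq_max => /andP[Nm km] mn; rewrite sum_nat_sub //.
  apply: le_lt_trans (hN m Nm); rewrite mul1r big_nat.
  apply: nrm_sum_le => // [|i /andP[mi _]].
    by apply: exprn_ge0; case/andP: hr.
  apply: le_trans (ha i (leq_trans km mi)) _.
  by case/andP: hr => r0 r1; apply: ler_wiXn2l => //; apply: ltW.
exists (maxn N k) => m n hm hn.
by have [mn|/ltnW nm] := leqP m n; [rewrite (nrmBC hu)|]; apply: h.
Qed.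

(** Dominated convergence: the geometric bound makes the tails small uniformly in N, and the
    remaining finite sums converge termwise. *)
Lemma ncvg_tannery (f : nat -> nat -> K) (g : nat -> K) (F : nat -> K) G k rho :
  0 <= rho < 1 ->
  (forall N i, (k <= i)%N -> nrm (f N i) <= rho ^+ i) ->
  (forall i, (k <= i)%N -> nrm (g i) <= rho ^+ i) ->
  (forall N, ncvg nrm (fun n => \sum_(k <= i < n) f N i) (F N)) ->
  ncvg nrm (fun n => \sum_(k <= i < n) g i) G ->
  (forall i, ncvg nrm (f ^~ i) (g i)) -> ncvg nrm F G.
Proof.
move=> hr hf hg hF hG hfg; apply/(ncvgP hu) => e e0.
(* Three errors below e add up to one below e; halving only turns the non-strict tail bounds into
   strict ones. *)
have e2 : 0 < e / 2 by lra.
have [I hI] := geometric_small 1 hr e2.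
pose J := maxn I k.
have tl i : (J <= i)%N -> (k <= i)%N /\ rho ^+ i <= e / 2.
  rewrite geq_max => /andP[Ii ki]; split => //.
  by have := hI i Ii; rewrite mul1r => /ltW.
have kJ : (k <= J)%N := leq_maxr _ _.
have /(ncvgP hu) /(_ e e0) [N hN] :=
  ncvg_sum hu (index_iota k J) (u := fun i N => f N i) hfg.
exists N => n /hN hn.
have -> : F n - G = (F n - \sum_(k <= i < J) f n i)
   + (\sum_(k <= i < J) f n i - \sum_(k <= i < J) g i)
   - (G - \sum_(k <= i < J) g i) by ring.
apply: (nrmB_lt hu); first apply: (nrmD_lt hu) => //.
- apply: (@le_lt_trans _ _ (e / 2)); last lra.
  apply: ncvg_series_tail => // [|i /tl [/(hf n)]]; first exact: ltW.
  exact: le_trans.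
- apply: (@le_lt_trans _ _ (e / 2)); last lra.
  apply: ncvg_series_tail => // [|i /tl [/hg]]; first exact: ltW.
  exact: le_trans.
Qed.

(** The square of index pairs is cut along i + j = N: the lower triangle is regrouped by n = i + j,
    the rest stays as remainder. *)
Lemma sum_mul_square (a b : nat -> K) (N : nat) :
  (\sum_(0 <= i < N) a i) * (\sum_(0 <= j < N) b j)
  = \sum_(0 <= n < N) (\sum_(0 <= i < n.+1) a i * b (n - i)%N)
    + \sum_(0 <= i < N) \sum_(N - i <= j < N) a i * b j.
Proof.
rewrite mulr_suml.
under [in LHS]eq_big_nat => i /andP[_ iN].
  rewrite mulr_sumr (@big_cat_nat _ _ _ (N - i)) ?leq_subr //=.
  over.
rewrite big_split /=; congr (_ + _).
under [RHS]eq_big_nat => n /andP[_ nN].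
  rewrite (@big_nat_widen _ _ _ _ _ N) //.
  over.
rewrite [RHS](exchange_big_dep_nat xpredT) //=.
apply: eq_big_nat => i /andP[_ iN].
rewrite [RHS](eq_bigl (fun j => true && (i <= j)%N)); last first.
  by move=> j; rewrite ltnS.
rewrite -(@big_nat_widenl _ _ _ i 0 N xpredT) //.
rewrite [RHS](@big_addn _ _ _ 0 N i); apply: eq_bigr => j _.
by rewrite addnK.
Qed.

(** Every remainder term has i + j >= N, hence norm at most rho^N, and so does their sum. *)
Lemma ncvg_cauchy_product (a b : nat -> K) (rho : R) A B : 0 <= rho < 1 ->
  (forall i, nrm (a i) <= rho ^+ i) -> (forall i, nrm (b i) <= rho ^+ i) ->
  ncvg nrm (fun n => \sum_(0 <= i < n) a i) A ->
  ncvg nrm (fun n => \sum_(0 <= i < n) b i) B ->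
  ncvg nrm (fun N => \sum_(0 <= n < N) \sum_(0 <= i < n.+1) a i * b (n - i)%N)
    (A * B).
Proof.
move=> hr ha hb hA hB; have /andP[r0 r1] := hr.
have hrest : ncvg nrm
    (fun N => \sum_(0 <= i < N) \sum_(N - i <= j < N) a i * b j) 0.
  apply: (ncvg_le0 hu (b := fun N => 1 * rho ^+ N)) => [N|e]; last first.
    exact: geometric_small.
  rewrite subr0 mul1r; have rN : 0 <= rho ^+ N by apply: exprn_ge0.
  rewrite big_nat; apply: nrm_sum_le => // i /andP[_ iN].
  rewrite big_nat; apply: nrm_sum_le => // j /andP[Nij _].
  rewrite (nrmM hu); apply: (@le_trans _ _ (rho ^+ i * rho ^+ j)).
    by apply: ler_pM => //; apply: nrm_ge0.
  by rewrite -exprD; apply: ler_wiXn2l; rewrite ?(ltW r1) // -leq_subLR.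
rewrite -[X in ncvg _ _ X]subr0.
apply: (eq_ncvg hu _ (ncvgD hu (ncvgM hu hA hB) (ncvgN hu hrest))) => N /=.
by rewrite sum_mul_square addrK.
Qed.

End Series.

(** * The p-adic exponential and logarithm *)

Section ExpLog.

Variables (p : nat) (R : realType) (K : fieldType) (nrm : K -> R).
Hypotheses (hp : prime p) (hu : ultrametric_norm nrm).
Hypothesis hc : forall u, ncauchy nrm u -> exists l, ncvg nrm u l.
Hypothesis hnp : nrm p%:R = p%:R^-1.

Let r : R := p%:R `^ (- (p.-1)%:R^-1).
Let exp := nexp nrm.
Let log := nlog nrm.

Let p0 : 0 < p%:R :> R. Proof. by rewrite ltr0n prime_gt0. Qed.

Let p1_gt0 : (0 < p.-1)%N. Proof. by have := prime_gt1 hp; lia. Qed.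

Lemma radius_gt0 : 0 < r. Proof. exact: powR_gt0. Qed.

Lemma radius_exp : r ^+ p.-1 = p%:R^-1.
Proof.
rewrite -powR_mulrn ?(ltW radius_gt0) // /r -powRrM mulNr mulVf.
  by rewrite powR_inv1 // ltW.
by rewrite pnatr_eq0 -lt0n.
Qed.

Let pV_lt1 : p%:R^-1 < 1 :> R.
Proof. by rewrite invf_lt1 // ltr1n prime_gt1. Qed.

Lemma radius_lt1 : r < 1.
Proof.
rewrite ltNge; apply/negP => h.
by have := exprn_ege1 p.-1 h; rewrite radius_exp leNgt pV_lt1.
Qed.

Let r0 := radius_gt0.
Let r1 := radius_lt1.

(** From a Bezout relation u p - v m = 1: since |p| < 1, |m| < 1 would give |1| < 1. *)
Lemma nrm_coprime m : coprime p m -> nrm m%:R = 1.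
Proof.
case/(coprimeP _ (prime_gt0 hp)) => -[u v] /= huv.
apply/eqP; rewrite eq_le nrm_nat_le1 // leNgt; apply/negP => h.
have h1 : nrm ((u * p)%:R - (v * m)%:R) < 1.
  apply: (nrmB_lt hu); rewrite natrM (nrmM hu).
    apply: (@le_lt_trans _ _ (nrm p%:R)); last by rewrite hnp.
    apply: ler_piMl; [exact: nrm_ge0|exact: nrm_nat_le1].
  apply: le_lt_trans h; apply: ler_piMl; [exact: nrm_ge0|exact: nrm_nat_le1].
have /(congr1 (fun k : nat => k%:R : K)) := huv.
rewrite natrB => [hK|]; last by move: huv; lia.
by move: h1; rewrite hK (nrm1 hu) ltxx.
Qed.

Lemma nrm_natE m : (0 < m)%N -> nrm m%:R = p%:R^-1 ^+ logn p m.
Proof.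
move=> m0; have [k pk mk] := pfactor_coprime hp m0.
by rewrite {1}mk natrM (nrmM hu) natrX (nrmX hu) hnp nrm_coprime // mul1r.
Qed.

(** With v = v_p(n!), |n!| = p^(-v) = r^((p-1) v), and (p-1) v <= n-1. *)
Lemma nrm_fact_ge n : r ^+ n.-1 <= nrm n`!%:R.
Proof.
rewrite nrm_natE ?fact_gt0 // -radius_exp -exprM.
by apply: ler_wiXn2l; [exact: ltW|exact: ltW|exact: logn_fact_le].
Qed.

Lemma nrm_nat_ge n : (0 < n)%N -> r ^+ n.-1 <= nrm n%:R.
Proof.
case: n => // n _; apply: le_trans (nrm_fact_ge _) _.
rewrite factS natrM (nrmM hu); apply: ler_piMr; first exact: nrm_ge0.
exact: nrm_nat_le1.
Qed.

Lemma natr_neq0 n : (0 < n)%N -> n%:R != 0 :> K.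
Proof.
move=> n0; rewrite -(nrm_gt0 hu); apply: lt_le_trans (nrm_nat_ge n0).
exact: exprn_gt0.
Qed.

(** One factor [nrm x] is kept outside the power of the ratio; it yields the estimates of exp x - 1
    and of the errors beyond the linear term. *)
Lemma nrm_term_le (x d : K) i : r ^+ i <= nrm d ->
  nrm (x ^+ i.+1 / d) <= nrm x * (nrm x / r) ^+ i.
Proof.
move=> hd; have ri : 0 < r ^+ i by apply: exprn_gt0.
rewrite (nrmM hu) (nrmX hu) (nrmV hu) exprS -mulrA expr_div_n.
apply: ler_wpM2l; first exact: nrm_ge0.
apply: ler_wpM2l; first by apply: exprn_ge0; apply: nrm_ge0.
by rewrite lef_pV2 ?posrE //; apply: lt_le_trans hd.
Qed.

Lemma ratio_lt1 (x : K) : nrm x < r -> 0 <= nrm x / r < 1.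
Proof.
move=> hx; rewrite ltr_pdivrMr // mul1r hx andbT.
by apply: divr_ge0; [exact: nrm_ge0|exact: ltW].
Qed.

Lemma nrm_term_le_geometric (x d : K) i : nrm x < r -> r ^+ i.-1 <= nrm d ->
  nrm (x ^+ i / d) <= (nrm x / r) ^+ i.
Proof.
move=> hx; have /andP[h0 _] := ratio_lt1 hx; case: i => [|i] hd.
  rewrite !expr0 mul1r (nrmV hu) invf_le1 //; exact: lt_le_trans hd.
apply: le_trans (nrm_term_le _ hd) _; rewrite exprS.
apply: ler_wpM2r; first exact: exprn_ge0.
by rewrite ler_pdivlMr //; apply: ler_piMr; [exact: nrm_ge0|exact: ltW].
Qed.

Lemma ncvg_exp x : nrm x < r ->
  ncvg nrm (fun n => \sum_(0 <= i < n) x ^+ i / (i`!)%:R) (exp x).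
Proof.
move=> hx.
have [l hl] := @ncvg_geometric _ _ _ hu hc
  (fun i => x ^+ i / (i`!)%:R) 0 _ (ratio_lt1 hx)
  (fun i _ => nrm_term_le_geometric hx (nrm_fact_ge i)).
by rewrite /exp /nexp (ncvg_nlim hu hl).
Qed.

Lemma nrm_log_term q i : nrm (q - 1) < r -> (0 < i)%N ->
  nrm ((-1) ^+ i.+1 * (q - 1) ^+ i / i%:R) <= (nrm (q - 1) / r) ^+ i.
Proof.
move=> hq i0; rewrite -mulrA (nrmM hu) (nrm_sign hu) mul1r.
exact: nrm_term_le_geometric (nrm_nat_ge i0).
Qed.

Lemma ncvg_log q : nrm (q - 1) < r ->
  ncvg nrm (fun n => \sum_(1 <= i < n) (-1) ^+ i.+1 * (q - 1) ^+ i / i%:R)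
    (log q).
Proof.
move=> hq.
have [l hl] := @ncvg_geometric _ _ _ hu hc
  (fun i => (-1) ^+ i.+1 * (q - 1) ^+ i / i%:R) 1 _ (ratio_lt1 hq)
  (fun i i0 => nrm_log_term hq i0).
by rewrite /log /nlog (ncvg_nlim hu hl).
Qed.

Let small_tail (x d : K) i k : nrm x < r -> (k < i)%N -> r ^+ i.-1 <= nrm d ->
  nrm (x ^+ i / d) <= nrm x * (nrm x / r) ^+ k.
Proof.
move=> hx; case: i => // i ki hd; apply: le_trans (nrm_term_le _ hd) _.
have /andP[h0 h1] := ratio_lt1 hx.
by apply: ler_wpM2l; [exact: nrm_ge0|apply: ler_wiXn2l => //; exact: ltW].
Qed.

Lemma nrm_expB1 x : nrm x < r -> nrm (exp x - 1) <= nrm x.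
Proof.
move=> hx.
suff : nrm (exp x - \sum_(0 <= i < 1) x ^+ i / (i`!)%:R) <= nrm x.
  by rewrite big_nat1 expr0 divr1.
apply: (ncvg_series_tail hu _ _ (ncvg_exp hx)) => //; first exact: nrm_ge0.
by move=> i i0; have := small_tail hx i0 (nrm_fact_ge i); rewrite expr0 mulr1.
Qed.

(** The error is quadratic in x, so for p^N x it still tends to 0 after division by p^N. *)
Lemma nrm_expB1B x : nrm x < r -> nrm (exp x - 1 - x) <= nrm x * (nrm x / r).
Proof.
move=> hx.
suff : nrm (exp x - \sum_(0 <= i < 2) x ^+ i / (i`!)%:R) <= nrm x * (nrm x / r).
  by rewrite !big_nat_recr //= big_nil expr0 expr1 !divr1 add0r opprD addrA.
apply: (ncvg_series_tail hu _ _ (ncvg_exp hx)) => //.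
  have /andP[h0 _] := ratio_lt1 hx.
  by apply: mulr_ge0 => //; exact: nrm_ge0.
by move=> i i1; have := small_tail hx i1 (nrm_fact_ge i); rewrite expr1.
Qed.

Lemma nrm_logB q : nrm (q - 1) < r ->
  nrm (log q - (q - 1)) <= nrm (q - 1) * (nrm (q - 1) / r).
Proof.
move=> hq.
suff : nrm (log q - \sum_(1 <= i < 2) (-1) ^+ i.+1 * (q - 1) ^+ i / i%:R)
       <= nrm (q - 1) * (nrm (q - 1) / r).
  by rewrite big_nat1 expr1 divr1 sqrrN !expr1n mul1r.
apply: (ncvg_series_tail hu _ _ (ncvg_log hq)) => //.
  have /andP[h0 _] := ratio_lt1 hq.
  by apply: mulr_ge0 => //; exact: nrm_ge0.
move=> i i1; rewrite -mulrA (nrmM hu) (nrm_sign hu) mul1r.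
by have := small_tail hq i1 (nrm_nat_ge (ltnW i1)); rewrite expr1.
Qed.

Lemma nrm_log_le q : nrm (q - 1) < r -> nrm (log q) <= nrm (q - 1).
Proof.
move=> hq; rewrite -[log q](subrK (q - 1)); apply: (nrmD_le hu) => //.
apply: le_trans (nrm_logB hq) _; have /andP[_ h1] := ratio_lt1 hq.
by apply: ler_piMr; [exact: nrm_ge0|exact: ltW].
Qed.

(** Unless q = 1, log q - (q - 1) is strictly shorter than q - 1. *)
Lemma log_eq0 q : nrm (q - 1) < r -> log q = 0 -> q = 1.
Proof.
move=> hq hl; apply/eqP; rewrite -subr_eq0 -(nrm_eq0 hu).
have := nrm_logB hq; rewrite hl sub0r (nrmN hu).
have /andP[_ h1] := ratio_lt1 hq; apply: contraTT => h.
rewrite -ltNge gtr_pMr // lt_def h; exact: nrm_ge0.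
Qed.

(** The n-th term of the Cauchy product is (x + y)^n / n! by the binomial theorem; the larger of the
    two ratios dominates both series. *)
Lemma nexpD x y : nrm x < r -> nrm y < r -> exp (x + y) = exp x * exp y.
Proof.
move=> hx hy; have hxy : nrm (x + y) < r by apply: nrmD_lt.
pose rho := Num.max (nrm x / r) (nrm y / r).
have /andP[x0 x1] := ratio_lt1 hx; have /andP[y0 y1] := ratio_lt1 hy.
have hrho : 0 <= rho < 1 by rewrite le_max x0 gt_max x1 y1.
have hX i : nrm (x ^+ i / i`!%:R) <= rho ^+ i.
  apply: le_trans (nrm_term_le_geometric hx (nrm_fact_ge i)) _.
  by apply: lerXn2r; rewrite ?nnegrE ?le_max ?x0 ?lexx.
have hY i : nrm (y ^+ i / i`!%:R) <= rho ^+ i.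
  apply: le_trans (nrm_term_le_geometric hy (nrm_fact_ge i)) _.
  by apply: lerXn2r; rewrite ?nnegrE ?le_max ?y0 ?lexx ?orbT.
apply: (ncvg_unique hu (ncvg_exp hxy)).
have hC := ncvg_cauchy_product hu hrho hX hY (ncvg_exp hx) (ncvg_exp hy).
apply: (eq_ncvg hu _ hC) => N.
apply: eq_bigr => n _; rewrite big_mkord addrC exprDn mulr_suml.
apply: eq_bigr => i _; have le_in : (i <= n)%N by rewrite -ltnS.
have hb : 'C(n, i)%:R * i`!%:R * (n - i)`!%:R = n`!%:R :> K.
  by rewrite -!natrM -mulnA bin_fact.
have f0 k : k`!%:R != 0 :> K by apply: natr_neq0; exact: fact_gt0.
rewrite -hb -[in RHS]mulr_natl; field.
rewrite !f0 /= natr_neq0 ?bin_gt0 //.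
Qed.

Lemma nrm_mul_lt c x : nrm c <= 1 -> nrm x < r -> nrm (c * x) < r.
Proof.
move=> hc1; apply: le_lt_trans; rewrite (nrmM hu).
by apply: ler_piMl => //; exact: nrm_ge0.
Qed.

Lemma nrm_natM_lt n x : nrm x < r -> nrm (n%:R * x) < r.
Proof. by apply: nrm_mul_lt; exact: nrm_nat_le1. Qed.

Lemma nexp0 : exp 0 = 1.
Proof.
have h0 : nrm 0 < r by rewrite (nrm0 hu).
apply/eqP; rewrite -subr_eq0 -(nrm_eq0 hu) eq_le nrm_ge0 // andbT.
by have := nrm_expB1 h0; rewrite (nrm0 hu).
Qed.

Lemma nexpX n x : nrm x < r -> exp (n%:R * x) = exp x ^+ n.
Proof.
move=> hx; elim: n => [|n IH]; first by rewrite mul0r nexp0.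
by rewrite -nat1r mulrDl mul1r nexpD ?IH ?exprS // nrm_natM_lt.
Qed.

(** * The logarithm as a limit of (q^(p^N) - 1) / p^N *)

Lemma nrm_pX N : nrm (p ^ N)%:R = p%:R^-1 ^+ N.
Proof. by rewrite natrX (nrmX hu) hnp. Qed.

Lemma pX_small (C e : R) : 0 < e ->
  exists N, forall n, (N <= n)%N -> C * nrm (p ^ n)%:R < e.
Proof.
move=> e0; have h : 0 <= (p%:R^-1 : R) < 1 by rewrite invr_ge0 ltW.
have [N hN] := geometric_small C h e0; exists N => n /hN.
by rewrite nrm_pX.
Qed.

Lemma ncvg_pX : ncvg nrm (fun N => (p ^ N)%:R) 0.
Proof.
apply: (ncvg_le0 hu (b := fun N => 1 * nrm (p ^ N)%:R)); last exact: pX_small.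
by move=> n; rewrite subr0 mul1r.
Qed.

Lemma pX_neq0 N : (p ^ N)%:R != 0 :> K.
Proof. by apply: natr_neq0; rewrite expn_gt0 prime_gt0. Qed.

(** With P = p^N, (j+1) C(P, j+1) = P C(P-1, j) tends to 0, so by Pascal's rule C(P-1, j+1) and
    -C(P-1, j) have the same limit. *)
Lemma ncvg_bin_pX j : ncvg nrm (fun N => 'C((p ^ N).-1, j)%:R) ((-1) ^+ j).
Proof.
elim: j => [|j IH].
  by apply: (eq_ncvg hu _ (ncvg_cst hu 1)) => N; rewrite bin0.
have h := ncvgZ hu (j.+1%:R^-1) (ncvg0M hu ncvg_pX IH).
rewrite mulr0 in h; rewrite exprS mulN1r -[X in ncvg _ _ X]add0r.
apply: (eq_ncvg hu _ (ncvgD hu h (ncvgN hu IH))) => N /=.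
rewrite -natrM mul_bin_diag natrM mulKf ?natr_neq0 //.
have pN : (0 < p ^ N)%N by rewrite expn_gt0 prime_gt0.
by rewrite -[in 'C(p ^ N, _)](prednK pN) binS natrD addrK.
Qed.

Lemma ncvg_log_pX q : nrm (q - 1) < r ->
  ncvg nrm (fun N => (q ^+ (p ^ N) - 1) / (p ^ N)%:R) (log q).
Proof.
move=> hq; pose u := q - 1.
(* As C(P, i) / P = C(P-1, i-1) / i for P = p^N, these are the terms of ((1 + u)^P - 1) / P. The
   integer binomials have norm at most 1, so the domination is uniform in N. *)
pose f N i := 'C((p ^ N).-1, i.-1)%:R * u ^+ i / i%:R.
apply: (ncvg_tannery hu (k := 1) (f := f) (ratio_lt1 hq) _ _ _ (ncvg_log hq)).
- move=> N i i0; rewrite /f -mulrA (nrmM hu) -[leRHS]mul1r.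
  apply: ler_pM; rewrite ?nrm_ge0 ?nrm_nat_le1 //.
  exact: nrm_term_le_geometric (nrm_nat_ge i0).
- by move=> i; exact: nrm_log_term.
- move=> N; have pN : (0 < p ^ N)%N by rewrite expn_gt0 prime_gt0.
  apply: (ncvg_eventually hu _ (ncvg_cst hu _)).
  (* The binomials vanish beyond i = p^N, so the partial sums are eventually constant. *)
  exists (p ^ N).+1 => n hn.
  rewrite (@big_cat_nat _ _ _ (p ^ N).+1) //=.
  have -> : \sum_((p ^ N).+1 <= i < n) f N i = 0.
    rewrite big_nat big1 // => i /andP[hi _].
    by rewrite /f bin_small ?mul0r //; lia.
  rewrite addr0.
  have -> : q = 1 + u by rewrite /u; ring.
  rewrite exprDn -(big_mkord xpredT
    (fun i => 1 ^+ (p ^ N - i) * u ^+ i *+ 'C(p ^ N, i))).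
  rewrite big_nat_recl // expr0 bin0 expr1n mulr1 mulr1n addrAC subrr add0r.
  rewrite big_add1 /= mulr_suml; apply: eq_bigr => i _.
  rewrite /f /= expr1n mul1r -mulr_natl.
  have := congr1 (fun k : nat => k%:R : K) (mul_bin_diag (p ^ N) i).
  have := pX_neq0 N; have : i.+1%:R != 0 :> K by exact: natr_neq0.
  rewrite !natrM.
  move: (p ^ N)%:R ('C(_, _)%:R) ('C(_, _)%:R) (i.+1%:R) (u ^+ _)
    => P a b c v c0 P0 e.
  have -> : a = P * b / c by rewrite e mulrAC divff ?mul1r // .
  by field; rewrite P0 c0.
(* The index 0 lies outside the series; there both terms are 0 because the inverse of 0 is 0. *)
case=> [|i].
  rewrite invr0 mulr0; apply: (eq_ncvg hu _ (ncvg_cst hu 0)) => N.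
  by rewrite /f invr0 !mulr0.
have -> : (-1) ^+ i.+2 * (q - 1) ^+ i.+1 / i.+1%:R
    = u ^+ i.+1 / i.+1%:R * (-1) ^+ i by rewrite !exprS; ring.
apply: (eq_ncvg hu _ (ncvgZ hu (u ^+ i.+1 / i.+1%:R) (ncvg_bin_pX i))) => N.
by rewrite /f /=; ring.
Qed.

Lemma nrm_lt_radius_eq1 q : nrm (q - 1) < r -> nrm q = 1.
Proof.
move=> hq; apply: (nrm_eq1 hu); rewrite (nrmBC hu).
exact: lt_trans hq r1.
Qed.

Lemma nrm_mulB1_lt a b : nrm (a - 1) < r -> nrm (b - 1) < r ->
  nrm (a * b - 1) < r.
Proof.
move=> ha hb; have -> : a * b - 1 = (a - 1) * b + (b - 1) by ring.
by apply: (nrmD_lt hu) => //; rewrite (nrmM hu) (nrm_lt_radius_eq1 hb) mulr1.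
Qed.

(** With P = p^N, ((ab)^P - 1)/P = ((a^P - 1)/P) b^P + (b^P - 1)/P, and b^P tends to 1. *)
Lemma nlogM a b : nrm (a - 1) < r -> nrm (b - 1) < r ->
  log (a * b) = log a + log b.
Proof.
move=> ha hb; have hab := nrm_mulB1_lt ha hb.
apply: (ncvg_unique hu (ncvg_log_pX hab)).
have hA := ncvg_log_pX ha; have hB := ncvg_log_pX hb.
have hb1 : ncvg nrm (fun N => b ^+ (p ^ N)) 1.
  have := ncvgD hu (ncvg0M hu ncvg_pX hB) (ncvg_cst hu 1); rewrite add0r.
  by apply: (eq_ncvg hu) => N /=; rewrite mulrC divfK ?subrK ?pX_neq0.
have := ncvgD hu (ncvgM hu hA hb1) hB; rewrite mulr1.
apply: (eq_ncvg hu) => N /=; rewrite exprMn; ring.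
Qed.

Lemma nrm_expB1_lt y : nrm y < r -> nrm (exp y - 1) < r.
Proof. by move=> hy; apply: le_lt_trans (nrm_expB1 hy) hy. Qed.

(** Here (exp x)^(p^N) = exp (p^N x), and the quadratic error of exp leaves an error of order |p^N|
    after division. *)
Lemma nexpK x : nrm x < r -> log (exp x) = x.
Proof.
move=> hx; apply: (ncvg_unique hu (ncvg_log_pX (nrm_expB1_lt hx))).
apply: (ncvg_le0 hu (b := fun N => (nrm x * nrm x / r) * nrm (p ^ N)%:R)).
  move=> N; have P0 := pX_neq0 N; rewrite -nexpX //.
  have hP : 0 < nrm (p ^ N)%:R by rewrite (nrm_gt0 hu).
  have -> : (exp ((p ^ N)%:R * x) - 1) / (p ^ N)%:R - x =
    (exp ((p ^ N)%:R * x) - 1 - (p ^ N)%:R * x) / (p ^ N)%:R by field.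
  rewrite (nrmM hu) (nrmV hu) ler_pdivrMr //.
  apply: le_trans (nrm_expB1B (nrm_natM_lt _ hx)) _.
  rewrite (nrmM hu) le_eqVlt; apply/orP; left; apply/eqP; ring.
by move=> e; exact: pX_small.
Qed.

(** For b = exp (log q), log b = log q by [nexpK]; hence log (q/b) = 0 and q = b. Since |b| = 1, q/b
    stays in the disc. *)
Lemma nlogK q : nrm (q - 1) < r -> exp (log q) = q.
Proof.
move=> hq; have hl : nrm (log q) < r := le_lt_trans (nrm_log_le hq) hq.
have hb := nrm_expB1_lt hl; set b := exp _ in hb *.
have nb := nrm_lt_radius_eq1 hb.
have b0 : b != 0 by rewrite -(nrm_eq0 hu) nb oner_eq0.
have hqb : nrm (q / b - 1) < r.
  have -> : q / b - 1 = (q - b) / b by field.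
  rewrite (nrmM hu) (nrmV hu) nb invr1 mulr1.
  have -> : q - b = (q - 1) - (b - 1) by ring.
  exact: (nrmB_lt hu).
have : log (q / b) = 0.
  apply: (addIr (log b)); rewrite -nlogM // divfK // add0r.
  by rewrite /b nexpK.
move/(log_eq0 hqb)/(congr1 ( *%R^~ b)); by rewrite divfK // mul1r.
Qed.

Lemma nrmX_sub1_lt q n : nrm (q - 1) < r -> nrm (q ^+ n - 1) < r.
Proof.
move=> hq; elim: n => [|n IH]; first by rewrite expr0 subrr (nrm0 hu).
by rewrite exprS; apply: nrm_mulB1_lt.
Qed.

Lemma nlogX q n : nrm (q - 1) < r -> log (q ^+ n) = n%:R * log q.
Proof.
move=> hq; have hl : nrm (log q) < r := le_lt_trans (nrm_log_le hq) hq.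
by rewrite -[in LHS](nlogK hq) -nexpX // nexpK // nrm_natM_lt.
Qed.

(** A root of unity in the disc has n log q = 0, hence log q = 0. *)
Lemma exprn_neq1 q n : nrm (q - 1) < r -> q != 1 -> (0 < n)%N -> q ^+ n != 1.
Proof.
move=> hq q1 n0; apply: contraNneq q1 => qn; apply/eqP/(log_eq0 hq).
have /eqP := nlogX n hq; rewrite qn.
have -> : log 1 = 0.
  by apply/eqP; rewrite -(nrm_eq0 hu) eq_le nrm_ge0 // andbT;
     have := @nrm_log_le 1; rewrite subrr (nrm0 hu); exact.
by rewrite eq_sym mulf_eq0 (negPf (natr_neq0 n0)) => /eqP.
Qed.

(** For p odd, 2 has norm 1, while q^n - 1 has norm below 1. *)
Lemma add1_exprn_neq0 q n : odd p -> nrm (q - 1) < r -> 1 + q ^+ n != 0.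
Proof.
move=> podd hq; have -> : 1 + q ^+ n = 2%:R + (q ^+ n - 1) by ring.
apply/eqP => /eqP; rewrite addr_eq0 => /eqP h.
have : nrm 2%:R < 1.
  by rewrite h (nrmN hu); apply: lt_trans (nrmX_sub1_lt n hq) r1.
by rewrite nrm_coprime ?ltxx // coprimen2.
Qed.

End ExpLog.

(** * q-Euler numbers and polynomials *)

(** Used to factor the sum over all k_j, whose ranges depend on j. Passing to [fprod] reduces it to
    the distributivity law for a dependent family of index sets. *)
Lemma dffun_distr_bigA (K : comNzRingType) (I : finType) (T : I -> finType)
    (F : forall i, T i -> K) :
  \sum_(k : {dffun forall i, T i}) \prod_i F i (k i)
  = \prod_i \sum_(a : T i) F i a.
Proof.
have bij := @dffun_of_fprod_bij I T.
rewrite (reindex (@dffun_of_fprod I T)); last exact: onW_bij.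
pose G i : {ffun T i -> K} := [ffun a => F i a].
transitivity (\sum_(t : fprod T) \prod_(i in I) G i (t i)).
  by apply: eq_bigr => t _; apply: eq_bigr => i _; rewrite !ffunE.
rewrite big_fprod; transitivity (\prod_i \sum_(a : T i) G i a).
  rewrite [RHS](eq_bigr _ (fun i _ => big_tag G i)).
  by rewrite bigA_distr_big_dep.
by apply: eq_bigr => i _; apply: eq_bigr => a _; rewrite ffunE.
Qed.

Lemma geometric_sum_odd (K : fieldType) (b : K) (w : nat) : odd w ->
  1 + b != 0 -> \sum_(a < w) (- b) ^+ a = (1 + b ^+ w) / (1 + b).
Proof.
move=> ow b0; apply: (mulfI b0); rewrite [RHS]mulrCA divff // mulr1.
have := subrX1 (- b) w; rewrite exprNn -signr_odd ow expr1 mulN1r => h.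
apply: oppr_inj; rewrite -mulNr opprD [X in X * _]addrC -h; ring.
Qed.

Lemma coef_1subZX (K : fieldType) (a : K) (l k : nat) :
  ((1 - a *: 'X) ^+ l)`_k = 'C(l, k)%:R * (- a) ^+ k.
Proof.
elim: l k => [|l IH] k.
  by rewrite expr0 coef1 bin0n; case: k => [|k]; rewrite ?mul1r ?mul0r.
rewrite exprS mulrBl mul1r -scalerAl coefB coefZ coefXM IH.
case: k => [|k]; first by rewrite /= !bin0 mulr0 subr0.
by rewrite /= IH binS natrD exprS; ring.
Qed.

(* With phi the linear functional X^k |-> c k and E l = phi ((1 - X)^l) / d^l,
   this is phi applied to ((1 - a X) / d)^m, expanded along
   1 - a X = a (1 - X) + (1 - a). *)
Lemma umbral_sum (K : fieldType) (c : nat -> K) (a d : K) (m : nat) : d != 0 ->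
  \sum_(l < m.+1) 'C(m, l)%:R * a ^+ l *
     ((\sum_(k < l.+1) 'C(l, k)%:R * (-1) ^+ k * c k) / d ^+ l)
     * ((1 - a) / d) ^+ (m - l)
  = (\sum_(k < m.+1) 'C(m, k)%:R * (-1) ^+ k * a ^+ k * c k) / d ^+ m.
Proof.
move=> d0; have dn0 i : d ^+ i != 0 by rewrite expf_neq0.
transitivity (\sum_(l < m.+1) \sum_(k < m.+1)
   ('C(m, l)%:R * a ^+ l * (1 - a) ^+ (m - l) * ('C(l, k)%:R * (-1) ^+ k))
   * c k / d ^+ m).
  apply: eq_bigr => l _; have lm : (l <= m)%N by rewrite -ltnS.
  have -> : \sum_(k < l.+1) 'C(l, k)%:R * (-1) ^+ k * c k
          = \sum_(k < m.+1) 'C(l, k)%:R * (-1) ^+ k * c k.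
    rewrite (big_ord_widen m.+1 (fun k => 'C(l, k)%:R * (-1) ^+ k * c k)) //.
    rewrite [RHS](bigID (fun k : 'I_m.+1 => (k < l.+1)%N)) /=.
    rewrite [X in _ = _ + X]big1 ?addr0 // => k; rewrite -leqNgt => lk.
    by rewrite bin_small ?mul0r.
  have -> : d ^+ m = d ^+ l * d ^+ (m - l) by rewrite -exprD subnKC.
  rewrite expr_div_n !mulr_suml mulr_sumr mulr_suml.
  apply: eq_bigr => k _; field.
  by rewrite !dn0.
rewrite exchange_big /= mulr_suml; apply: eq_bigr => k _.
rewrite -!mulr_suml; congr (_ * _ / _).
have h : (1 - a *: 'X) = (1 - a)%:P + a *: (1 - 1 *: 'X) :> {poly K}.
  by rewrite scale1r scalerBr polyCB polyC1 alg_polyC addrA subrK.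
(* The coefficient of X^k in (1 - a X)^m is computed directly and from the expansion in powers of 1
   - X. *)
have := coef_1subZX a m k; rewrite [in LHS]h exprDn coef_sum => e.
transitivity ('C(m, k)%:R * (- a) ^+ k); last first.
  by rewrite (exprNn a) mulrA.
rewrite -e; apply: eq_bigr => l _.
rewrite coefMn -polyC_exp coefCM exprZn coefZ coef_1subZX -[in RHS]mulr_natl.
by ring.
Qed.

Section QEuler.

Variables (R : realType) (K : fieldType) (nrm : K -> R) (Q : K).
Hypotheses (Q1 : Q != 1) (QX : forall k, 1 + Q ^+ k.+1 != 0).
Hypothesis hbr : qbracket nrm Q 2%:R = 1 + Q.

Let d0 : 1 - Q != 0. Proof. by rewrite subr_eq0 eq_sym. Qed.

(** The moment of Q^(k y) under the measure mu_(-Q). *)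
Let c k : K := (1 + Q) / (1 + Q ^+ k.+1).

(** The integral of [y]_Q^m under mu_(-Q), with (1 - Q^y)^m expanded. *)
Definition qEuler_closed (m : nat) : K :=
  (\sum_(k < m.+1) 'C(m, k)%:R * (-1) ^+ k * ((1 + Q) / (1 + Q ^+ k.+1)))
  / (1 - Q) ^+ m.

(** By [umbral_sum] at a = Q, the k-th term gets the factor Q Q^k + 1, which cancels its
    denominator. What remains is (1 + Q) (1 - 1)^m / (1 - Q)^m. *)
Lemma qEuler_closedP : is_qEuler nrm Q qEuler_closed.
Proof.
split=> [|m].
  rewrite /qEuler_closed big_ord1 expr0 bin0 !mul1r divr1 expr1 divff //.
  exact: (QX 0).
have -> : \sum_(l < m.+1) 'C(m, l)%:R * Q ^+ l * qEuler_closed l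
    = (\sum_(k < m.+1) 'C(m, k)%:R * (-1) ^+ k * Q ^+ k * c k) / (1 - Q) ^+ m.
  rewrite -umbral_sum //; apply: eq_bigr => l _.
  by rewrite divff // expr1n mulr1.
rewrite /qEuler_closed mulrA -mulrDl mulr_sumr -big_split /=.
rewrite hbr (eq_bigr (fun k : 'I_m.+1 =>
  (1 + Q) * (1 ^+ (m - k) * (-1) ^+ k *+ 'C(m, k)))).
  rewrite -mulr_sumr -exprDn subrr expr0n; case: m => [|m] /=.
    by rewrite expr0 divr1.
  by rewrite !mulr0 mul0r.
move=> k _; rewrite /c expr1n mul1r -[in RHS]mulr_natl.
have := QX k; rewrite exprS => hk; field.
exact: hk.
Qed.

Lemma is_qEuler_unique E E' : is_qEuler nrm Q E -> is_qEuler nrm Q E' -> E = E'.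
Proof.
move=> [_ hE] [_ hE']; apply: funext => m.
elim/ltn_ind: m => m IH.
have := etrans (hE m) (esym (hE' m)); rewrite !big_ord_recr /= binn.
rewrite (eq_bigr (fun l : 'I_m => 'C(m, l)%:R * Q ^+ l * E' l)); last first.
  by move=> l _; rewrite IH.
set S := \sum_(i < m) _ => h.
apply: (mulfI (QX m)); rewrite exprS.
have lin e : (1 + Q * Q ^+ m) * e = Q * (S + 1 * Q ^+ m * e) + e - Q * S.
  by ring.
by rewrite !lin h.
Qed.

Lemma qEulerE : qEuler nrm Q = qEuler_closed.
Proof.
apply: xget_unique; first exact: qEuler_closedP.
by move=> E hE; apply: is_qEuler_unique hE qEuler_closedP.
Qed.

(** This is [umbral_sum] at a = Q^z. *)
Lemma qEuler_polyE (m : nat) (z : K) :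
  (forall l, npow nrm Q (l%:R * z) = npow nrm Q z ^+ l) ->
  qEuler_poly nrm m Q z =
  (1 + Q) / (1 - Q) ^+ m *
  \sum_(k < m.+1) 'C(m, k)%:R * (-1) ^+ k * npow nrm Q z ^+ k / (1 + Q ^+ k.+1).
Proof.
move=> hz; have h := umbral_sum c (npow nrm Q z) m d0.
rewrite /qEuler_poly qEulerE.
under eq_bigr do rewrite hz.
rewrite {}h [RHS]mulrAC mulr_sumr; congr (_ / _).
apply: eq_bigr => k _; rewrite /c; ring.
Qed.

End QEuler.

(** * Symmetry of the signed sums over the k_j *)

Lemma prod_wE (n : nat) (w : 'I_n.+1 -> nat) (s : 'S_n.+1) :
  (\prod_i w i = wlast w s * Wprod w s)%N.
Proof.
rewrite (reindex_inj (@perm_inj _ s)) /= (bigD1_ord ord_max) //=.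
Qed.

(** The exponent is the sum of (P / w_(s j)) k_j, so the sum is a product of geometric sums. As W_s
    = P / w_(s n), the denominator 1 + b^(W_s) is exactly the factor missing from the product over
    all weights. *)
Lemma sum_signed_Ksum (K : fieldType) (n : nat) (w : 'I_n.+1 -> nat)
    (s : 'S_n.+1) (b : K) :
  (forall i, odd (w i)) -> (forall j, 1 + b ^+ j.+1 != 0) ->
  (\sum_(k : {dffun forall j : 'I_n, 'I_(wfst w s j)})
     (-1) ^+ (\sum_(j < n) k j)%N
     * (b ^+ (wlast w s * Ksum w s (fun j => k j))%N)) / (1 + b ^+ Wprod w s)
  = (1 + b ^+ (\prod_i w i)) ^+ n
    / \prod_i (1 + b ^+ ((\prod_i w i) %/ w i)).
Proof.
move=> wodd hb; set P := (\prod_i w i)%N.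
have w0 i : (0 < w i)%N by case: (w i) (wodd i).
have P0 : (0 < P)%N by apply: prodn_gt0.
have Pw i : (0 < P %/ w i)%N.
  by rewrite divn_gt0 // dvdn_leq // /P (bigD1 i) //= dvdn_mulr.
have Pn0 i : 1 + b ^+ (P %/ w i) != 0 by rewrite -(prednK (Pw i)) hb.
have eW : Wprod w s = (P %/ w (s ord_max))%N.
  by rewrite /P (prod_wE w s) /wlast mulKn ?w0.
have eP j :
    (wlast w s * \prod_(i < n | i != j) wfst w s i)%N = (P %/ wfst w s j)%N.
  rewrite /P (prod_wE w s) /Wprod [in RHS](bigD1 j) //= mulnCA mulKn //.
  exact: w0.
transitivity (\prod_(j < n) (\sum_(a < wfst w s j)
     (- b ^+ (P %/ wfst w s j)) ^+ a)
   / (1 + b ^+ Wprod w s)).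
  congr (_ / _).
  rewrite -(dffun_distr_bigA (fun j (a : 'I_(wfst w s j)) =>
    (- b ^+ (P %/ wfst w s j)) ^+ a)).
  apply: eq_bigr => k _; rewrite /Ksum big_distrr /= -!prodrXr -big_split /=.
  apply: eq_bigr => j _.
  by rewrite mulnA eP exprM -exprNn.
rewrite (eq_bigr (fun j =>
  (1 + b ^+ P) / (1 + b ^+ (P %/ wfst w s j)))); last first.
  move=> j _; rewrite geometric_sum_odd ?wodd //; last exact: Pn0.
  rewrite -exprM divnK // /P (prod_wE w s) dvdn_mull // /Wprod (bigD1 j) //=.
  exact: dvdn_mulr.
rewrite prodf_div prodr_const card_ord -mulrA -invfM; congr (_ / _).
rewrite [RHS](reindex_inj (@perm_inj _ s)) /= (bigD1_ord ord_max) //= eW mulrC.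
by [].
Qed.


(** * Evaluation of the symmetric expression *)

Section Symmetry.

Variables (p : nat) (R : realType) (K : fieldType) (nrm : K -> R).
Hypotheses (hp : prime p) (hodd : odd p) (hu : ultrametric_norm nrm).
Hypothesis hc : forall u, ncauchy nrm u -> exists l, ncvg nrm u l.
Hypothesis hnp : nrm p%:R = p%:R^-1.

Let r : R := p%:R `^ (- (p.-1)%:R^-1).

Lemma npow_nat (Q : K) n : nrm (Q - 1) < r -> npow nrm Q n%:R = Q ^+ n.
Proof.
move=> hQ; rewrite /npow (nexpX hp hu hc hnp) ?(nlogK hp hu hc hnp) //.
exact: le_lt_trans (nrm_log_le hp hu hc hnp hQ) hQ.
Qed.

Lemma qbracket2 (Q : K) : nrm (Q - 1) < r -> Q != 1 ->
  qbracket nrm Q 2%:R = 1 + Q.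
Proof.
move=> hQ Q1; rewrite /qbracket npow_nat // -[X in X - _](expr1n _ 2) subr_sqr.
by rewrite mulrAC divff ?mul1r // subr_eq0 eq_sym.
Qed.

(** Clears the denominators w_(s j), so that these parts of z contribute integer powers of q to
    Q^z. *)
Lemma Wprod_ratio (n : nat) (w : 'I_n.+1 -> nat) (s : 'S_n.+1)
    (k : 'I_n -> nat) :
  (forall i, (0 < w i)%N) ->
  (\sum_(j < n) (k j)%:R / (wfst w s j)%:R) * (Wprod w s)%:R
  = (Ksum w s k)%:R :> K.
Proof.
move=> w0; rewrite mulr_suml natr_sum; apply: eq_bigr => j _.
have wj : (wfst w s j)%:R != 0 :> K by apply: (natr_neq0 hp hu hnp); exact: w0.
rewrite /Wprod (bigD1 j) //= !natrM.
move: (\prod_(i < n | _) _)%N => v; field.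
exact: wj.
Qed.

(** The right-hand side does not contain [s]; this is the symmetry. *)
Lemma sym_exprE (q x : K) (n : nat) (w : 'I_n.+1 -> nat) (m : nat)
    (s : 'S_n.+1) :
  q != 1 -> nrm (q - 1) < r -> nrm x <= 1 -> (forall i, odd (w i)) ->
  let P := (\prod_i w i)%N in
  sym_expr nrm q x w m s =
  (\sum_(l < m.+1) 'C(m, l)%:R * (-1) ^+ l
     * nexp nrm (P%:R * x * nlog nrm q) ^+ l
     * ((1 + (q ^+ l.+1) ^+ P) ^+ n
         / \prod_i (1 + (q ^+ l.+1) ^+ (P %/ w i)))) / (1 - q) ^+ m.
Proof.
move=> q1 hq hx wodd P.
have w0 i : (0 < w i)%N by case: (w i) (wodd i).
have W0 : (0 < Wprod w s)%N by apply: prodn_gt0 => j; exact: w0.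
have add1X (c : K) k : nrm (c - 1) < r -> 1 + c ^+ k != 0.
  by move=> hcr; exact: (add1_exprn_neq0 hp hu hnp).
have hL : nrm (nlog nrm q) < r := le_lt_trans (nrm_log_le hp hu hc hnp hq) hq.
set W := Wprod w s; set L := nlog nrm q; set A := nexp nrm _.
have hQ : nrm (q ^+ W - 1) < r by exact: (nrmX_sub1_lt hp hu).
have Q1 : q ^+ W != 1 by exact: (exprn_neq1 hp hu hc hnp).
have hPx : nrm (P%:R * x * L) < r.
  apply: (nrm_mul_lt hu) => //; rewrite (nrmM hu).
  by apply: mulr_ile1; rewrite ?nrm_ge0 ?nrm_nat_le1.
pose e (k : {dffun forall j : 'I_n, 'I_(wfst w s j)}) :=
  (wlast w s * Ksum w s (fun j => k j))%N.
pose z (k : {dffun forall j : 'I_n, 'I_(wfst w s j)}) : K :=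
  (wlast w s)%:R * x
          + (wlast w s)%:R * \sum_(j < n) (k j)%:R / (wfst w s j)%:R.
(* A weight divisible by p may put [z k] outside Z_p, but log (q^W) = W log q cancels the
   denominators, and the product lies in the disc of exp. *)
have zL k : z k * nlog nrm (q ^+ W) = P%:R * x * L + (e k)%:R * L.
  rewrite (nlogX hp hu hc hnp) // /z /e /P (prod_wE w s) !natrM -Wprod_ratio //.
  by rewrite -/W -/L; ring.
have zX k l : npow nrm (q ^+ W) (l%:R * z k) = (A * q ^+ e k) ^+ l.
  have he : nrm ((e k)%:R * L) < r by exact: (nrm_natM_lt hu).
  rewrite /npow -mulrA zL (nexpX hp hu hc hnp); last exact: (nrmD_lt hu).
  rewrite (nexpD hp hu hc hnp) // (nexpX hp hu hc hnp) //.
  by rewrite (nlogK hp hu hc hnp).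
have zE k : npow nrm (q ^+ W) (z k) = A * q ^+ e k.
  by rewrite -[z k]mul1r (zX k 1%N) expr1.
rewrite /sym_expr -/W qbracket2 // {1}/qbracket npow_nat //.
have dq : 1 - q != 0 by rewrite subr_eq0 eq_sym.
have dQ : 1 - q ^+ W != 0 by rewrite subr_eq0 eq_sym.
have hQX l : 1 + (q ^+ W) ^+ l.+1 != 0 by exact: add1X.
have hQ0 : 1 + q ^+ W != 0 by exact: (hQX 0%N).
pose T (k : {dffun forall j : 'I_n, 'I_(wfst w s j)}) l : K :=
  'C(m, l)%:R * (-1) ^+ l * A ^+ l * ((-1) ^+ (\sum_(j < n) k j)%N
   * (q ^+ l.+1) ^+ e k / (1 + (q ^+ l.+1) ^+ W)).
(* The factor [2]_Q cancels 1 + Q, and [W]_q^m turns (1 - Q)^(-m) into (1 - q)^(-m). *)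
transitivity (\sum_k \sum_(l < m.+1) T k l / (1 - q) ^+ m).
  rewrite mulr_sumr; apply: eq_bigr => k _.
  rewrite (qEuler_polyE Q1 hQX (qbracket2 hQ Q1)); last first.
    by move=> l; rewrite zX zE.
  rewrite zE expr_div_n -/(e k) !mulr_sumr; apply: eq_bigr => l _.
  rewrite /T; move: (e k) (hQX l) => ek.
  rewrite [(q ^+ l.+1) ^+ ek]exprAC [(q ^+ l.+1) ^+ W]exprAC.
  set B := (_ ^+ W) ^+ _ => hB.
  rewrite exprMn [(q ^+ ek) ^+ l.+1]exprS.
  by field; rewrite hB hQ0 !expf_neq0.
(* For fixed l the sum over k is [sum_signed_Ksum] at b = q^(l+1). *)
rewrite exchange_big mulr_suml; apply: eq_bigr => l _ /=.
rewrite -mulr_suml -mulr_sumr -mulr_suml sum_signed_Ksum // => j.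
by apply: add1X; exact: (nrmX_sub1_lt hp hu).
Qed.

End Symmetry.

Theorem theorem2p2 (p : nat) (hp : prime p) (hodd : odd p)
    (R : realType) (K : fieldType) (nrm : K -> R) (hK : is_Cp p nrm)
    (q : K) (hq1 : q != 1) (hq : nrm (1 - q) < p%:R `^ (- (p.-1)%:R^-1))
    (x : K) (hx : padic_Z nrm x)
    (n : nat) (w : 'I_n.+1 -> nat)
    (hwpos : forall i, (0 < w i)%N) (hwodd : forall i, odd (w i))
    (m : nat) (s t : 'S_n.+1) :
  sym_expr nrm q x w m s = sym_expr nrm q x w m t.
Proof.
case: hK => hu hnp hc _ _.
have hx1 := nrm_padic_Z hu hx.
rewrite (nrmBC hu) in hq.
by rewrite !(sym_exprE hp hodd hu hc hnp).
Qed.
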